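(* If $C$ is a sparse Cantor subset of an interval $\mathcal C^1$-embedded into a compact orientable manifold $M$, then the group $\mathfrak{diff}^1_M(C)$ is countable and discrete.
   Context: A Cantor set is a (nonempty) compact totally disconnected set without isolated points. A Cantor subset $C$ of an interval of $\mathbb R$ is $\sigma$-sparse if for any $a<b$ in $C$ there is a complementary interval $(\alpha,\beta)\subset (a,b)\cap (\mathbb R\setminus C)$ such that $\beta-\alpha\geq \sigma(b-a)$; it is sparse if it is $\sigma$-sparse for some $\sigma>0$. In the claim, $C\subset M$ is the image of a sparse Cantor subset of an interval under a $\mathcal C^1$-embedding of the interval into $M$. $\mathrm{Diff}^1(M,C)$ is the group of $\mathcal C^1$-diffeomorphisms of $M$ sending $C$ to itself, and $\mathfrak{diff}^1_M(C)$ is the group of transformations of $C$ that arise as restrictions to $C$ of elements of $\mathrm{Diff}^1(M,C)$, endowed with the topology induced (as a quotient, via restriction) by the $\mathcal C^1$ topology on $\mathrm{Diff}^1(M,C)$. *)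

(* Defs.v *)
From HB Require Import structures.
From mathcomp Require Import all_boot all_order all_algebra.
From mathcomp Require Import all_classical all_reals all_analysis.
Set Implicit Arguments.
Unset Strict Implicit.
Unset Printing Implicit Defensive.
Import Order.TTheory GRing.Theory Num.Theory.
Import numFieldNormedType.Exports.
Local Open Scope classical_set_scope.
Local Open Scope ring_scope.

Definition cantor_set (T : topologicalType) (K : set T) : Prop :=
  [/\ K !=set0, compact K, totally_disconnected K & isolated K = set0].

(* A complementary interval is a bounded component of the complement, so its
   endpoints belong to [K]. *)
Definition complementary_interval (R : realType) (K : set R) (u v : R) : Prop :=
  [/\ u < v, K u, K v & `]u, v[ `<=` ~` K].

Definition sigma_sparse (R : realType) (sigma : R) (K : set R) : Prop :=
  forall a b, K a -> K b -> a < b ->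
  exists u v, [/\ complementary_interval K u v, `]u, v[ `<=` `]a, b[ &
                  sigma * (b - a) <= v - u].

Definition sparse (R : realType) (K : set R) : Prop :=
  exists2 sigma : R, 0 < sigma & sigma_sparse sigma K.

(* Differentials are taken along the filter [within D (nbhs x)], as [D] need
   not be a neighbourhood of [x]: below, [D] is relatively open in a half-space
   or in an interval, and the differential of [f] at [x] within [D] is unique.
   As the spaces are finite-dimensional, pointwise continuity of [x |-> 'd f]
   is the same as continuity in operator norm. *)
Definition C1_within (R : realType) (V W : normedModType R) (D : set V)
    (f : V -> W) : Prop :=
  (forall x, D x -> differentiable f (within D (nbhs x))) /\
  forall v, {within D, continuous (fun x => 'd f (within D (nbhs x)) v)}.

Definition jacobian_within (R : realType) (m n : nat) (D : set 'rV[R]_m)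
    (f : 'rV[R]_m -> 'rV[R]_n) (x : 'rV[R]_m) : 'M[R]_(m, n) :=
  lin1_mx ('d f (within D (nbhs x))).

(* The first coordinate is nonnegative; this is the whole space if [n = 0]. *)
Definition half_space (R : realType) (n : nat) : set 'rV[R]_n :=
  [set x | forall i : 'I_n, i = 0%N :> nat -> 0 <= x ord0 i].

(* [cmap] and [cinv] are junk-valued outside [cdom] and [cmap @` cdom]. *)
Record chart (R : realType) (n : nat) (M : topologicalType) := Chart {
  cdom : set M ;
  cmap : M -> 'rV[R]_n ;
  cinv : 'rV[R]_n -> M }.

Definition is_chart (R : realType) (n : nat) (M : topologicalType)
    (c : chart R n M) : Prop :=
  [/\ open (cdom c),
      exists2 U, open U & cmap c @` cdom c = U `&` @half_space R n,
      {in cdom c, cancel (cmap c) (cinv c)},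
      {within cdom c, continuous (cmap c)} &
      {within cmap c @` cdom c, continuous (cinv c)}].

(* Expression of [f : M -> M] in the charts [c] (source) and [d] (target). *)
Definition coord (R : realType) (n : nat) (M : topologicalType)
    (c d : chart R n M) (f : M -> M) : 'rV[R]_n -> 'rV[R]_n :=
  cmap d \o f \o cinv c.

Definition coord_dom (R : realType) (n : nat) (M : topologicalType)
    (c d : chart R n M) (f : M -> M) : set 'rV[R]_n :=
  cmap c @` (cdom c `&` f @^-1` cdom d).

Definition coord_jacobian (R : realType) (n : nat) (M : topologicalType)
    (c d : chart R n M) (f : M -> M) : 'rV[R]_n -> 'M[R]_n :=
  jacobian_within (coord_dom c d f) (coord c d f).

(* Charts take their values in a half-space: this covers manifolds with and
   without boundary, as a chart with open image may be restricted to the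
   preimages of balls and translated into the interior of the half-space. *)
Definition C1_atlas (R : realType) (n : nat) (M : topologicalType)
    (A : set (chart R n M)) : Prop :=
  [/\ forall c, A c -> is_chart c,
      \bigcup_(c in A) cdom c = setT &
      forall c d, A c -> A d -> C1_within (coord_dom c d idfun) (coord c d idfun)].

(* A continuous orientation of the tangent spaces: [s c x] tells whether the
   chart [c] is positively oriented at [x]. Asking instead for an atlas with
   positive transition Jacobians would be wrong for compact intervals, as all
   charts take their values in the same half-line. *)
Definition orientable (R : realType) (n : nat) (M : topologicalType)
    (A : set (chart R n M)) : Prop :=
  exists s : chart R n M -> M -> bool,
    (forall c, A c -> {within cdom c, continuous (s c)}) /\
    (forall c d x, A c -> A d -> cdom c x -> cdom d x ->
       (0 < \det (coord_jacobian c d idfun (cmap c x))) = (s c x == s d x)).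

Definition C1_map (R : realType) (n : nat) (M : topologicalType)
    (A : set (chart R n M)) (f : M -> M) : Prop :=
  continuous f /\
  forall c d, A c -> A d -> C1_within (coord_dom c d f) (coord c d f).

Definition C1_diffeo (R : realType) (n : nat) (M : topologicalType)
    (A : set (chart R n M)) (f : M -> M) : Prop :=
  C1_map A f /\
  exists g : M -> M, [/\ C1_map A g, cancel f g & cancel g f].

(* A C^1 immersion of the interval [i] that is a homeomorphism onto its image;
   the values of [gamma] outside [i] are irrelevant. *)
Definition C1_embedding (R : realType) (n : nat) (M : topologicalType)
    (A : set (chart R n M)) (i : interval R) (gamma : R -> M) : Prop :=
  [/\ {within [set` i], continuous gamma},
      (exists g : M -> R, {in i, cancel gamma g} /\
         {within gamma @` [set` i], continuous g}) &
      forall c, A c ->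
        let D : set R^o := [set` i] `&` gamma @^-1` cdom c in
        let h : R^o -> 'rV[R]_n := cmap c \o gamma in
        C1_within D h /\
        forall t, D t -> 'd h (within D (nbhs t)) 1 != 0].

Definition Diff1 (R : realType) (n : nat) (M : topologicalType)
    (A : set (chart R n M)) (C : set M) : set (M -> M) :=
  [set f | C1_diffeo A f /\ f @` C = C].

Definition Diff1_type (R : realType) (n : nat) (M : topologicalType)
    (A : set (chart R n M)) (C : set M) : Type := set_type (Diff1 A C).

HB.instance Definition _ R n M A C := Choice.on (@Diff1_type R n M A C).

(* Subbasic open set of the (compact-open) C^1 topology: the maps sending the compact set [L]
   into [cdom d] that are [e]-close to [f] on [L], together with their first
   derivatives, in the charts [c] and [d]. *)
Definition C1_close (R : realType) (n : nat) (M : topologicalType)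
    (f : M -> M) (c d : chart R n M) (L : set M) (e : R) : set (M -> M) :=
  [set g | g @` L `<=` cdom d /\ forall x, L x ->
     `|coord c d g (cmap c x) - coord c d f (cmap c x)| < e /\
     `|coord_jacobian c d g (cmap c x) - coord_jacobian c d f (cmap c x)| < e].

Definition C1_subbase (R : realType) (n : nat) (M : topologicalType)
    (A : set (chart R n M)) : set (set (M -> M)) :=
  [set W | exists f c d L e,
     [/\ C1_map A f, A c /\ A d, compact L /\ L `<=` cdom c,
         f @` L `<=` cdom d & 0 < e /\ W = C1_close f c d L e]].

(* The trace on Diff^1(M, C) of the C^1 topology. *)
HB.instance Definition _ (R : realType) (n : nat) (M : topologicalType)
    (A : set (chart R n M)) (C : set M) :=
  @isSubBaseTopological.Build (Diff1_type A C) (set (M -> M)) (C1_subbase A)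
    (fun W => [set f | W (val f)]).

Lemma Diff1_stable (R : realType) (n : nat) (M : topologicalType)
    (A : set (chart R n M)) (C : set M) (f : Diff1_type A C) (x : set_type C) :
  val f (val x) \in C.
Proof.
have [_ fC] := set_mem (valP f); apply: mem_set.
have : (val f @` C) (val f (val x)) by exists (val x) => //; exact: set_valP.
by rewrite fC.
Qed.

Definition restr (R : realType) (n : nat) (M : topologicalType)
    (A : set (chart R n M)) (C : set M) (f : Diff1_type A C) :
    set_type C -> set_type C :=
  fun x => exist _ (val f (val x)) (Diff1_stable f x).

(* The transformations of [C] that are restrictions of elements of
   Diff^1(M, C). *)
Definition diff1 (R : realType) (n : nat) (M : topologicalType)
    (A : set (chart R n M)) (C : set M) : Type :=
  set_type (range (@restr R n M A C)).

HB.instance Definition _ R n M A C := Choice.on (@diff1 R n M A C).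

Definition to_diff1 (R : realType) (n : nat) (M : topologicalType)
    (A : set (chart R n M)) (C : set M) (f : Diff1_type A C) : diff1 A C :=
  exist _ (restr f) (mem_set (imageT (@restr R n M A C) f)).

(* The quotient topology along the restriction map. *)
Definition diff1_open (R : realType) (n : nat) (M : topologicalType)
    (A : set (chart R n M)) (C : set M) : set_system (diff1 A C) :=
  [set U | open (@to_diff1 R n M A C @^-1` U)].

Lemma diff1_openT (R : realType) (n : nat) (M : topologicalType)
    (A : set (chart R n M)) (C : set M) : diff1_open [set: diff1 A C].
Proof. by rewrite /diff1_open/= preimage_setT; exact: openT. Qed.

Lemma diff1_openI (R : realType) (n : nat) (M : topologicalType)
    (A : set (chart R n M)) (C : set M) : setI_closed (@diff1_open R n M A C).
Proof. by move=> U V oU oV; rewrite /diff1_open/= preimage_setI; exact: openI. Qed.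

Lemma diff1_open_bigcup (R : realType) (n : nat) (M : topologicalType)
    (A : set (chart R n M)) (C : set M) (I : Type) (U : I -> set (diff1 A C)) :
  (forall i, diff1_open (U i)) -> diff1_open (\bigcup_i U i).
Proof.
move=> oU; rewrite /diff1_open/= preimage_bigcup.
by apply: bigcup_open => i _; exact: oU.
Qed.

HB.instance Definition _ (R : realType) (n : nat) (M : topologicalType)
    (A : set (chart R n M)) (C : set M) :=
  isOpenTopological.Build (diff1 A C) (@diff1_openT R n M A C)
    (@diff1_openI R n M A C) (@diff1_open_bigcup R n M A C).

(* Main.v *)
Require Import Defs.
From mathcomp Require Import all_boot all_order all_algebra.
From mathcomp Require Import all_classical all_reals all_analysis.
From mathcomp Require Import ring lra.
Set Implicit Arguments.
Unset Strict Implicit.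
Unset Printing Implicit Defensive.
Import Order.TTheory GRing.Theory Num.Theory.
Import numFieldNormedType.Exports.
Local Open Scope classical_set_scope.
Local Open Scope ring_scope.

(** Every [f] in [Diff1 A C] is read through the curve [gamma] as a bijection
    [curve_map f] of the parameter set [K], and two elements have the same
    restriction to [C] as soon as their parameter maps agree on [K].

    The heart of the matter is a rigidity property of a [sigma]-sparse compact
    set [E] of reals ([sparse_rigid]): a map [th] from [E] to itself such that
    [th - id] is [eps]-Lipschitz with [eps < sigma] is the identity. Indeed, if
    [x < th x], let [p] be the first point beyond [x] that [th] does not move
    to the right. Between [x] and [p] there is a gap [(u, v)] of [E] of length
    at least [sigma * (p - x)], and [th] has to carry [u] across it, because it
    moves [u] to the right inside [E]. The displacement [th - id] thus varies by
    at least [sigma * (p - u)] between [u] and [p], which is too much. Applied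
    to [phi^-1 \o psi], this shows that [phi] and [psi] agree on [E] when both
    are almost affine there with the same slope and [psi] maps [E] into
    [phi @` E] ([sparse_slope_rigid]).

    A C^1 map is strictly differentiable, by the mean value inequality on
    convex sets, which is available up to the boundary because half-spaces and
    intervals are convex ([strict_diff]). Comparing [gamma \o curve_map f] with
    [f \o gamma] in charts, and projecting on a coordinate in which the
    velocity of the curve does not vanish, [curve_map f] is found to be almost
    affine near each point of [K], with a slope that stays valid for all [g]
    close to [f] in the C^1 topology ([strict_slope_near]); the slope is not
    zero because [f] is invertible and [K] has no isolated point
    ([strict_slope_neq0]). Cutting [K] at points of its complement yields
    clopen pieces of [K], and the inclusion
    [curve_map g @` E `<=` curve_map f @` E] of the images of such a piece also
    persists for [g] close to [f] ([near_image_sub]).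

    Discreteness follows: by compactness of [K], all [g] close to [f] have the
    same restriction to [C] as [f] ([near_curve_map_eq]). For countability, the
    end points of the pieces, the slopes and a description of the images of
    the pieces may all be chosen rational; finitely many such data cover [K]
    and determine the restriction of [f] ([finite_description]). *)

(** * Rigidity of sparse sets *)

Section sparse_rigidity.
Variable R : realType.
Implicit Types (K E : set R) (th : R -> R).

Lemma itvooE (u v t : R) : `]u, v[%classic t = (u < t < v) :> Prop.
Proof. by rewrite /= in_itv. Qed.

Lemma itvoo_sub_le (u v a b : R) :
  u < v -> `]u, v[ `<=` `]a, b[ -> a <= u /\ v <= b.
Proof.
move=> uv uvab.
have mid t : u < t < v -> a < t < b.
  by move=> tuv; have := uvab t; rewrite !itvooE; exact.
split; rewrite leNgt; apply/negP => H.
- have m1 : Num.min a v <= a by rewrite ge_min lexx.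
  have m2 : Num.min a v <= v by rewrite ge_min lexx orbT.
  have m3 : u < Num.min a v by rewrite lt_min H.
  have /mid/andP[] : u < (u + Num.min a v) / 2 < v by apply/andP; split; lra.
  lra.
- have m1 : b <= Num.max b u by rewrite le_max lexx.
  have m2 : u <= Num.max b u by rewrite le_max lexx orbT.
  have m3 : Num.max b u < v by rewrite gt_max H.
  have /mid/andP[] : u < (Num.max b u + v) / 2 < v by apply/andP; split; lra.
  lra.
Qed.

(** Sparseness survives here because the gap found between two points of an
    order-convex part of [K] has its end points in that part. *)
Lemma sigma_sparse_trace K (q r sigma : R) :
  sigma_sparse sigma K -> sigma_sparse sigma (K `&` `]q, r[).
Proof.
move=> sK a b [Ka]; rewrite itvooE => /andP[qa _] [Kb].
rewrite itvooE => /andP[_ br] ab.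
have [u [v [[uv Ku Kv uvK] uvab len]]] := sK _ _ Ka Kb ab.
have [au vb] := itvoo_sub_le uv uvab.
exists u, v; split => //; split => //.
- by split => //; rewrite itvooE; apply/andP; split; lra.
- by split => //; rewrite itvooE; apply/andP; split; lra.
- by move=> t /uvK nK [].
Qed.

Lemma sigma_sparse_opp K (sigma : R) :
  sigma_sparse sigma K -> sigma_sparse sigma (-%R @^-1` K).
Proof.
move=> sK a b Ka Kb ab.
have [|u [v [[uv Ku Kv uvK] uvab len]]] := sK _ _ Kb Ka; first by rewrite ltrN2.
exists (- v), (- u); split; [split| |].
- by rewrite ltrN2.
- by rewrite /= opprK.
- by rewrite /= opprK.
- move=> t; rewrite itvooE => /andP[vt tu]; apply: uvK.
  by rewrite itvooE; apply/andP; split; lra.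
- move=> t; rewrite !itvooE => /andP[vt tu].
  have := uvab (- t); rewrite !itvooE => H.
  have /andP[] : - b < - t < - a by apply: H; apply/andP; split; lra.
  by rewrite !ltrN2 => -> ->.
- lra.
Qed.

(** The gap argument, for displacements to the right; the mirror image of [E]
    takes care of displacements to the left. *)
Lemma sparse_displacement_le E th (sigma eps : R) :
  compact E -> sigma_sparse sigma E -> eps < sigma ->
  (forall x, E x -> E (th x)) ->
  (forall x y, E x -> E y -> `|(th x - x) - (th y - y)| <= eps * `|x - y|) ->
  forall x, E x -> th x <= x.
Proof.
move=> cE sE es thE thL x Ex; rewrite leNgt; apply/negP => xth.
pose S := [set y | [/\ E y, x <= y & th y <= y]].
have clE : closed E by apply: compact_closed => //; exact: Rhausdorff.
have [m Em mE] : exists2 m, E m & forall y, E y -> y <= m.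
  have [||m mE0 mE] := @compact_EVT_max _ R idfun E _ cE; first by exists x.
    by apply: continuous_subspaceT => y; exact: cvg_id.
  by exists m; [exact: set_mem|move=> y Ey; apply: mE; exact: mem_set].
have hiS : has_inf S.
  split; last by exists x => y [].
  by exists m; split; [|apply: mE|apply/mE/thE].
set p := inf S.
have xp : x <= p by apply: lb_le_inf; [case: hiS|move=> y []].
have near_p d : 0 < d -> exists2 y, S y & `|y - p| < d.
  move=> d0; have [y Sy yp] := inf_adherent d0 hiS.
  exists y => //; have py : p <= y by apply: ge_inf => //; case: hiS.
  by rewrite ger0_norm ?subr_ge0// ltrBlDl.
have Ep : E p.
  apply: clE => B /nbhs_ballP[d/= d0 dB].
  have [y [Ey _ _] yp] := near_p d d0; exists y; split => //.
  by apply: dB; rewrite -ball_normE /= distrC.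
(* The displacement is continuous, so the infimum is attained. *)
have thp : th p <= p.
  rewrite leNgt; apply/negP => pth.
  have e1 : 0 < `|eps| + 1 by rewrite ltr_wpDl.
  pose d := (th p - p) / (`|eps| + 1).
  have d0 : 0 < d by rewrite divr_gt0// subr_gt0.
  have [y [Ey _ yS] yp] := near_p d d0.
  have := thL p y Ep Ey; rewrite leNgt => /negP; apply.
  have : `|eps| * `|p - y| < th p - p.
    apply: (@le_lt_trans _ _ ((`|eps| + 1) * `|p - y|)).
      by rewrite mulrDl mul1r lerDl.
    by rewrite distrC mulrC -ltr_pdivlMr.
  have : eps * `|p - y| <= `|eps| * `|p - y| by rewrite ler_wpM2r// ler_norm.
  have : th p - p - (th y - y) <= `|th p - p - (th y - y)| by rewrite ler_norm.
  lra.
have xltp : x < p.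
  by rewrite lt_neqAle xp andbT; apply/eqP => xpE; move: thp; rewrite -xpE; lra.
have [u [v [[uv Eu Ev uvE] uvxp len]]] := sE _ _ Ex Ep xltp.
have [xu vp] := itvoo_sub_le uv uvxp.
(* [th u] cannot fall inside the gap, so [th] carries [u] across it. *)
have thu : u < th u.
  rewrite ltNge; apply/negP => thu.
  have : p <= u by apply: ge_inf; [case: hiS|split].
  lra.
have vth : v <= th u.
  rewrite leNgt; apply/negP => thv.
  have : ~ E (th u) by apply: uvE; rewrite itvooE thu thv.
  by apply; apply: thE.
have := thL u p Eu Ep.
rewrite (ler0_norm (_ : u - p <= 0)); last by lra.
have : th u - u - (th p - p) <= `|th u - u - (th p - p)| by rewrite ler_norm.
have [e0|e0] := leP eps 0.
  have : eps * - (u - p) <= 0 by rewrite mulr_le0_ge0//; lra.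
  lra.
have : sigma * (p - u) <= sigma * (p - x) by rewrite ler_pM2l; lra.
have : eps * (p - u) < sigma * (p - u) by rewrite ltr_pM2r; lra.
lra.
Qed.

Lemma sparse_rigid E th (sigma eps : R) :
  compact E -> sigma_sparse sigma E -> eps < sigma ->
  (forall x, E x -> E (th x)) ->
  (forall x y, E x -> E y -> `|(th x - x) - (th y - y)| <= eps * `|x - y|) ->
  forall x, E x -> th x = x.
Proof.
move=> cE sE es thE thL x Ex; apply/eqP; rewrite eq_le.
rewrite (sparse_displacement_le cE sE es thE thL Ex)/=.
have cE' : compact (-%R @^-1` E).
  have -> : -%R @^-1` E = -%R @` E.
    apply/seteqP; split => [y Ey|_ [y Ey <-]]; last by rewrite /= opprK.
    by exists (- y) => //; rewrite opprK.
  apply: continuous_compact => //; apply: continuous_subspaceT.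
  exact: opp_continuous.
have /= := @sparse_displacement_le _ (fun y => - th (- y)) _ _ cE'
  (sigma_sparse_opp sE) es _ _ (- x).
rewrite !opprK lerN2; apply => //.
- by move=> y Ey /=; rewrite opprK; exact: thE.
- move=> y z Ey Ez; have := thL _ _ Ey Ez.
  rewrite (_ : - th (- y) - y - (- th (- z) - z) =
    - (th (- y) - - y - (th (- z) - - z))); last by ring.
  by rewrite (_ : - y - - z = - (y - z)) ?normrN//; ring.
Qed.

(** The error is relative to the slope [d], so that [d] cancels out of the
    comparison below. *)
Definition slope_on E (d e : R) (phi : R -> R) : Prop :=
  forall y z, E y -> E z ->
    `|phi y - phi z - d * (y - z)| <= e * `|d| * `|y - z|.

Lemma slope_compare (d s t T e : R) : d != 0 -> 0 <= e -> e < 1 ->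
  `|s - d * T| <= e * `|d| * `|T| -> `|s - d * t| <= e * `|d| * `|t| ->
  `|T - t| <= (2 * e / (1 - e)) * `|t|.
Proof.
move=> d0 e0 e1 h1 h2.
have dp : 0 < `|d| by rewrite normr_gt0.
have h3 : `|T - t| <= e * `|T| + e * `|t|.
  rewrite -(ler_pM2l dp) -normrM [leRHS]mulrDr.
  rewrite (_ : d * (T - t) = (s - d * t) - (s - d * T)); last by ring.
  apply: le_trans (ler_normB _ _) _; rewrite [leRHS]addrC lerD//.
    by rewrite mulrCA mulrA.
  by rewrite mulrCA mulrA.
have h4 : `|T| <= `|t| + `|T - t|.
  by have := ler_normD t (T - t); rewrite addrC subrK.
rewrite mulrAC ler_pdivlMr; last by rewrite subr_gt0.
have : e * `|T| <= e * (`|t| + `|T - t|) by rewrite ler_wpM2l.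
lra.
Qed.

(** The inclusion of the images makes [phi^-1 \o psi] a map from [E] to itself;
    [slope_compare] bounds the Lipschitz constant of its displacement. *)
Lemma sparse_slope_rigid (E : set R) (phi psi : R -> R) (sigma e : R) (d : R) :
  compact E -> sigma_sparse sigma E -> d != 0 ->
  0 <= e -> e < 1 -> 2 * e / (1 - e) < sigma ->
  psi @` E `<=` phi @` E ->
  slope_on E d e phi -> slope_on E d e psi ->
  forall y, E y -> psi y = phi y.
Proof.
move=> cE sE d0 e0 e1 es img sphi spsi.
have /choice[th thP] y : exists z, E y -> E z /\ phi z = psi y.
  have [Ey|nEy] := pselect (E y); last by exists 0.
  by have [|z Ez zy] := img (psi y); [exists y|exists z].
have th_id : forall y, E y -> th y = y.
  apply: (sparse_rigid cE sE es).
    by move=> y /thP[].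
  move=> y z Ey Ez.
  have [Ey' py] := thP _ Ey; have [Ez' pz] := thP _ Ez.
  rewrite (_ : _ - _ - _ = (th y - th z) - (y - z)); last ring.
  apply: (slope_compare d0 e0 e1 (s := psi y - psi z)); last exact: spsi.
  by rewrite -py -pz; exact: sphi.
by move=> y Ey; have [_ <-] := thP _ Ey; rewrite th_id.
Qed.

End sparse_rigidity.

(** * Strict differentiability of C^1 maps on convex sets *)

Lemma subrACA (V : zmodType) (x y z t : V) : x - y - (z - t) = x - z - (y - t).
Proof. by rewrite !opprD addrACA. Qed.

Lemma dist_increments (R : numDomainType) (W : normedZmodType R)
    (gy gx fy fx u v : W) (p q r : R) :
  `|gy - gx - v| <= p -> `|fy - fx - u| <= q -> `|v - u| <= r ->
  `|gy - fy - (gx - fx)| <= p + q + r.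
Proof.
move=> hG hF hd.
have -> : gy - fy - (gx - fx) = (gy - gx - v) - (fy - fx - u) + (v - u).
  by rewrite [X in _ = X + _]subrACA subrK subrACA.
apply: le_trans (ler_normD _ _) (lerD _ hd).
exact: le_trans (ler_normB _ _) (lerD hG hF).
Qed.

Lemma dist_perturb (R : numDomainType) (W : normedZmodType R)
    (gu gv fu fv w : W) (p q : R) :
  `|fu - fv - w| <= p -> `|gu - fu - (gv - fv)| <= q ->
  `|gu - gv - w| <= p + q.
Proof.
move=> h1 h2.
have -> : gu - gv - w = (fu - fv - w) + (gu - fu - (gv - fv)).
  by rewrite [X in _ = _ + X]subrACA [RHS]addrC [RHS]addrA subrK.
exact: le_trans (ler_normD _ _) (lerD h1 h2).
Qed.

Section strict_differentiability.
Variable R : realType.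

Definition is_convex (V : lmodType R) (B : set V) : Prop :=
  forall (x y : V) (t : R), B x -> B y -> 0 <= t <= 1 -> B (x + t *: (y - x)).

Lemma is_convexI (V : lmodType R) (A B : set V) :
  is_convex A -> is_convex B -> is_convex (A `&` B).
Proof. by move=> cA cB x y t [Ax Bx] [Ay By] t01; split; [exact: cA|exact: cB]. Qed.

Lemma norm_segment_le (V : normedModType R) (p x y : V) (t k : R) :
  0 <= t <= 1 -> `|p - x| <= k -> `|p - y| <= k ->
  `|p - (x + t *: (y - x))| <= k.
Proof.
move=> /andP[t0 t1] px py.
have -> : p - (x + t *: (y - x)) = (1 - t) *: (p - x) + t *: (p - y).
  rewrite scalerBl scale1r -addrA !scalerBr opprB [_ *: x - _ + _]addrA subrK.
  by rewrite opprD addrA opprB.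
apply: le_trans (ler_normD _ _) _; rewrite !normrZ (ger0_norm t0).
rewrite ger0_norm ?subr_ge0//.
have : (1 - t) * `|p - x| <= (1 - t) * k by rewrite ler_wpM2l// subr_ge0.
have : t * `|p - y| <= t * k by rewrite ler_wpM2l.
lra.
Qed.

Lemma is_convex_ball (V : normedModType R) (p : V) (e : R) :
  is_convex (ball p e).
Proof.
move=> x y t; rewrite -!ball_normE /= => px py t01.
apply: (@le_lt_trans _ _ (Num.max `|p - x| `|p - y|)); last by rewrite gt_max px.
by apply: norm_segment_le => //; rewrite le_max lexx ?orbT.
Qed.

(** The supremum of the times up to which the bound holds is such a time, and
    the local hypothesis pushes it further unless it is [1]. *)
Lemma mean_value_unit (W : normedModType R) (g : R -> W) (k : R) :
  0 <= k ->
  (forall t : R, 0 <= t <= 1 -> \forall s \near t, 0 <= s <= 1 ->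
     `|g s - g t| <= k * `|s - t|) ->
  `|g 1 - g 0| <= k.
Proof.
move=> k0 gk.
pose S := [set t : R | 0 <= t <= 1 /\ `|g t - g 0| <= k * t].
have S0 : S 0 by split; rewrite ?lexx ?ler01// subrr normr0 mulr0.
have hS : has_sup S.
  by split; [exists 0|exists 1 => t [/andP[]]].
set m := sup S.
have m0 : 0 <= m by apply: ub_le_sup => //; case: hS.
have m1 : m <= 1 by apply: ge_sup; [exists 0|move=> t [/andP[]]].
have m01 : 0 <= m <= 1 by rewrite m0 m1.
have /nbhs_ballP[d /= d0 gd] := gk m m01.
have Sm : S m.
  split => //; have [t [t01 gt] mt] := sup_adherent d0 hS.
  have tm : t <= m by apply: ub_le_sup => //; case: hS.
  have := gd t _ t01; rewrite -ball_normE /= ger0_norm ?subr_ge0// -/m => H.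
  have {H} : `|g t - g m| <= k * `|t - m| by apply: H; rewrite -/m in mt; lra.
  rewrite distrC ler0_norm ?subr_le0// => H.
  rewrite -(subrK (g t) (g m)) -addrA; apply: le_trans (ler_normD _ _) _; lra.
have [m_eq1|m_neq1] := eqVneq m 1.
  by have [_] := Sm; rewrite m_eq1 mulr1.
have mlt1 : m < 1 by rewrite lt_neqAle m_neq1.
pose s := Num.min 1 (m + d / 2).
have ms : m < s by rewrite lt_min mlt1 ltrDl divr_gt0.
have s1 : s <= 1 by rewrite ge_min lexx.
have smd : s <= m + d / 2 by rewrite ge_min lexx orbT.
have s01 : 0 <= s <= 1 by apply/andP; split; lra.
suff : S s by move=> Ss; have : s <= m by [apply: ub_le_sup => //; case: hS]; lra.
split => //.
have := gd s _ s01; rewrite -ball_normE /= ltr0_norm ?subr_lt0// => H.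
have {H} : `|g s - g m| <= k * `|s - m| by apply: H; lra.
rewrite gtr0_norm ?subr_gt0// => H.
have [_ H'] := Sm.
rewrite -(subrK (g m) (g s)) -addrA; apply: le_trans (ler_normD _ _) _; lra.
Qed.

(** Only increments within [B] matter, so the inequality also applies at points
    where [B] is not a neighbourhood, such as boundary points. The slack [e]
    absorbs the remainder of a first-order expansion. *)
Lemma mean_value (V W : normedModType R) (B : set V) (f : V -> W) (k : R) :
  is_convex B -> 0 <= k ->
  (forall x, B x -> forall e, 0 < e ->
     \forall y \near x, B y -> `|f y - f x| <= (k + e) * `|y - x|) ->
  forall x y, B x -> B y -> `|f y - f x| <= k * `|y - x|.
Proof.
move=> cB k0 fk x y Bx By; apply/ler_addgt0Pr => e e0.
have yx1 : 0 < `|y - x| + 1 by rewrite ltr_wpDl.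
pose e' := e / (`|y - x| + 1).
have e'0 : 0 < e' by rewrite divr_gt0.
pose p (t : R) := x + t *: (y - x).
have Bp t : 0 <= t <= 1 -> B (p t) by exact: cB.
have pB s t : p s - p t = (s - t) *: (y - x).
  by rewrite /p opprD addrACA subrr add0r scalerBl.
have pc : continuous p.
  move=> t; apply: cvgD; first exact: cvg_cst.
  by apply: cvgZ; [exact: cvg_id|exact: cvg_cst].
have p1 : p 1 = y by rewrite /p scale1r addrC subrK.
have p0 : p 0 = x by rewrite /p scale0r addr0.
have : `|(f \o p) 1 - (f \o p) 0| <= (k + e') * `|y - x|.
  apply: mean_value_unit; first by rewrite mulr_ge0// addr_ge0// ltW.
  move=> t t01.
  have H : \forall s \near t, B (p s) ->
      `|f (p s) - f (p t)| <= (k + e') * `|p s - p t|.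
    exact: (pc t _ (fk _ (Bp t t01) _ e'0)).
  apply: filterS H => s H s01; apply: le_trans (H (Bp s s01)) _.
  by rewrite pB normrZ mulrCA mulrC.
rewrite /= p1 p0 => /le_trans; apply.
by rewrite mulrDl lerD2l /e' mulrAC ler_pdivrMr// ler_wpM2l ?ltW// ltrDl.
Qed.

(** The differential along [within D (nbhs x)] is expanded at the limit of that
    filter, which is [x] because [D x] makes the filter proper. *)
Lemma diff_within_near (V W : normedModType R) (D : set V) (f : V -> W) (x : V) :
  D x -> differentiable f (within D (nbhs x)) -> forall e, 0 < e ->
  \forall y \near x, D y ->
    `|f y - f x - 'd f (within D (nbhs x)) (y - x)| <= e * `|y - x|.
Proof.
move=> Dx df e e0.
have PF : ProperFilter (within D (nbhs x)).
  apply: Build_ProperFilter_ex => P /nbhs_singleton Px; exists x; exact: Px.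
have limx : lim (within D (nbhs x)) = x.
  by apply: (@cvg_lim _ (@norm_hausdorff R V) V _ PF idfun); exact: cvg_within.
case: df => -[_ H].
move: H; rewrite limx => /eqaddoP /(_ e e0).
apply: filterS => y H.
have -> : f y - f x - 'd f (within D (nbhs x)) (y - x) =
  f y - (f x + 'd f (within D (nbhs x)) (y - x)) by rewrite opprD addrA.
exact: H.
Qed.

(** Coordinates bounded by the norm turn the pointwise convergence of linear
    maps into convergence in operator norm. This is stated so as to cover both
    row vectors and the line [R^o], on which a curve is differentiated. *)
Definition bounded_frame (V : normedModType R) (m : nat) (b : 'I_m -> V)
    (c : V -> 'I_m -> R) : Prop :=
  forall v, v = \sum_i c v i *: b i /\ forall i, `|c v i| <= `|v|.

Lemma mx_entry_le_norm m n (M : 'M[R]_(m, n)) i j : `|M i j| <= `|M|.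
Proof.
rewrite [leRHS]/Num.Def.normr/= mx_normrE.
exact: (le_bigmax _ (fun k : 'I_m * 'I_n => `|M k.1 k.2|) (i, j)).
Qed.

Lemma bounded_frame_row n :
  bounded_frame (fun i => delta_mx 0 i : 'rV[R]_n) (fun v i => v 0 i).
Proof.
move=> v; split; first exact: row_sum_delta.
by move=> i; exact: mx_entry_le_norm.
Qed.

Lemma bounded_frame_line :
  @bounded_frame R^o 1 (fun _ => 1) (fun v _ => v).
Proof. by move=> v; split=> //; rewrite big_ord1; exact/esym/mulr1. Qed.

Lemma linear_bound (V W : normedModType R) m (b : 'I_m -> V) c (L : {linear V -> W}) k :
  bounded_frame b c -> (forall i, `|L (b i)| <= k) ->
  forall v, `|L v| <= m%:R * k * `|v|.
Proof.
move=> bc Lk v; have [vE cv] := bc v.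
rewrite {1}vE linear_sum; apply: le_trans (ler_norm_sum _ _ _) _.
apply: (@le_trans _ _ (\sum_(i < m) k * `|v|)).
  apply: ler_sum => i _; rewrite linearZ normrZ mulrC.
  by apply: ler_pM; rewrite ?normr_ge0 ?Lk ?cv.
by rewrite sumr_const card_ord -mulrA mulr_natl.
Qed.

Lemma mean_value_diff (V W : normedModType R) (B D : set V) (f : V -> W)
    (L : V -> W) (k : R) :
  is_convex B -> B `<=` D -> 0 <= k ->
  (forall x y, L (x - y) = L x - L y) ->
  (forall x, B x -> differentiable f (within D (nbhs x))) ->
  (forall x v, B x -> `|'d f (within D (nbhs x)) v - L v| <= k * `|v|) ->
  forall x y, B x -> B y -> `|f y - f x - L (y - x)| <= k * `|y - x|.
Proof.
move=> cB BD k0 LB df dfk x y Bx By.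
rewrite LB (_ : _ - _ - _ = (f y - L y) - (f x - L x)); last first.
  by rewrite !opprD !opprK addrACA.
apply: (mean_value (f := fun z => f z - L z) cB k0) => // {x y Bx By}x Bx e e0.
apply: filterS (diff_within_near (BD _ Bx) (df _ Bx) e0) => z H Bz.
have {}H := H (BD _ Bz).
rewrite (_ : _ - _ = (f z - f x - 'd f (within D (nbhs x)) (z - x)) +
   ('d f (within D (nbhs x)) (z - x) - L (z - x))); last first.
  by rewrite addrA subrK LB !opprD !opprK addrACA.
by apply: le_trans (ler_normD _ _) _; rewrite mulrDl addrC lerD// dfk.
Qed.

(** The differentials of [F] and [G] are taken within different sets, as the
    domains of the coordinate expressions of two maps differ. *)
Lemma mean_value_diff_sub (V W : normedModType R) (B DF DG : set V)
    (F G : V -> W) (k : R) :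
  is_convex B -> B `<=` DF -> B `<=` DG -> 0 <= k ->
  (forall x, B x -> differentiable F (within DF (nbhs x))) ->
  (forall x, B x -> differentiable G (within DG (nbhs x))) ->
  (forall x v, B x -> `|'d G (within DG (nbhs x)) v -
                        'd F (within DF (nbhs x)) v| <= k * `|v|) ->
  forall x y, B x -> B y -> `|(G y - F y) - (G x - F x)| <= k * `|y - x|.
Proof.
move=> cB BF BG k0 dF dG dFG.
apply: (mean_value (f := fun y => G y - F y) cB k0) => x Bx e e0.
have e20 : 0 < e / 2 by rewrite divr_gt0.
have nF := diff_within_near (BF _ Bx) (dF _ Bx) e20.
have nG := diff_within_near (BG _ Bx) (dG _ Bx) e20.
apply: filterS2 nF nG => y nF nG By.
move: (nF (BF _ By)) (nG (BG _ By)) (dFG x (y - x) Bx).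
move=> hF hG hd; apply: le_trans (dist_increments hG hF hd) _.
by rewrite -mulrDl -splitr -mulrDl addrC.
Qed.

(** [B] rather than [D] has to be convex; near a point, the ball and the
    half-space or interval cut out such a set. *)
Lemma strict_diff (V W : normedModType R) m (b : 'I_m -> V) c
    (D B : set V) (f : V -> W) (x0 : V) :
  bounded_frame b c -> C1_within D f -> D x0 -> is_convex B -> B `<=` D ->
  forall e, 0 < e -> exists2 d, 0 < d & forall y z, B y -> B z ->
    ball x0 d y -> ball x0 d z ->
    `|f y - f z - 'd f (within D (nbhs x0)) (y - z)| <= e * `|y - z|.
Proof.
move=> bc [df cdf] Dx0 cB BD e e0.
pose L := 'd f (within D (nbhs x0)).
pose k := e / (m%:R + 1).
have k0 : 0 < k by rewrite divr_gt0// ltr_wpDl.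
have : \forall y \near x0, forall i, D y ->
    `|'d f (within D (nbhs y)) (b i) - L (b i)| <= k.
  apply: filter_forall => i.
  have /subspace_continuousP/(_ x0 Dx0)/cvgrPdist_le/(_ k k0) := cdf (b i).
  by apply: filterS => y H; rewrite distrC.
move=> /nbhs_ballP[d/= d0 Hd]; exists d => // y z By Bz dy dz.
apply: (@mean_value_diff _ _ (B `&` ball x0 d) D) => //.
- by apply: is_convexI => //; exact: is_convex_ball.
- by move=> t [/BD].
- exact: ltW.
- exact: linearB.
- by move=> t [/BD Dt _]; exact: df.
- move=> t v [Bt dt].
  have := @linear_bound _ _ _ _ _
    ('d f (within D (nbhs t)) \- 'd f (within D (nbhs x0))) k bc
    (fun i => Hd t dt i (BD _ Bt)) v.
  move=> /le_trans; apply; rewrite ler_wpM2r//.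
  rewrite /k mulrCA -[leRHS]mulr1 ler_wpM2l ?(ltW e0)//.
  by rewrite ler_pdivrMr ?ltr_wpDl// mul1r lerDl.
Qed.

End strict_differentiability.

Lemma row_norm_le (R : realType) m n (M : 'M[R]_(m, n)) i : `|row i M| <= `|M|.
Proof.
rewrite [leLHS]/Num.Def.normr/= mx_normrE; apply: bigmax_le => // -[k j] _ /=.
by rewrite mxE; exact: mx_entry_le_norm.
Qed.

Lemma lin1_mx_dist (R : realType) m n
    (L1 L2 : {linear 'rV[R]_m -> 'rV[R]_n}) k i :
  `|lin1_mx L1 - lin1_mx L2| <= k ->
  `|(L1 \- L2) (delta_mx 0 i)| <= k.
Proof.
apply: le_trans; apply: le_trans (row_norm_le _ i).
by rewrite rowE mulmxBr !mul_rV_lin1.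
Qed.

(** * Charts *)

Lemma closed_norm_ball (R : realType) (V : normedModType R) (x : V) (r : R) :
  closed [set y | `|x - y| <= r].
Proof.
have /continuous_closedP H : continuous (fun y => `|x - y|); last first.
  exact: (H _ (@closed_le _ r)).
by move=> y; apply: cvg_norm; exact: (cvgB (cvg_cst x) cvg_id).
Qed.

Section charts.
Variables (R : realType) (n : nat) (M : topologicalType).
Implicit Types (c d : chart R n M) (p : M) (x y : 'rV[R]_n).

(** Convex, so that the mean value inequality applies on it, and compact, so
    that its image under [cinv] is a legitimate compact set of the C^1
    topology. *)
Definition coord_box x (r : R) : set 'rV[R]_n :=
  [set y | `|x - y| <= r] `&` @half_space R n.

Lemma is_convex_half_space : is_convex (@half_space R n).
Proof.
move=> x y t hx hy /andP[t0 t1] j j0; rewrite !mxE.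
have := hx j j0; have := hy j j0.
have -> : x ord0 j + t * (y ord0 j - x ord0 j) =
  (1 - t) * x ord0 j + t * y ord0 j by ring.
by move=> ? ?; rewrite addr_ge0// mulr_ge0// subr_ge0.
Qed.

Lemma closed_half_space : closed (@half_space R n).
Proof.
have -> : @half_space R n =
    \bigcap_(j in [set j : 'I_n | j = 0%N :> nat]) [set x | 0 <= x ord0 j].
  by apply/seteqP; split => x hx j; exact: hx.
apply: closed_bigI => j _.
have /continuous_closedP H := @coord_continuous R 1 n ord0 j.
exact: (H _ (@closed_ge _ 0)).
Qed.

Lemma coord_box_convex x r : is_convex (coord_box x r).
Proof.
apply: is_convexI; last exact: is_convex_half_space.
by move=> y z t /= xy xz t01; exact: norm_segment_le.
Qed.

Lemma coord_box_compact x r : compact (coord_box x r).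
Proof.
apply: bounded_closed_compact.
  exists (`|x| + r); split; first exact: num_real.
  move=> t xrt y [/= xy _]; apply: le_trans (ltW xrt).
  rewrite -(subrK x y) addrC; apply: le_trans (ler_normD _ _) _.
  by rewrite lerD2l distrC.
apply: closedI; last exact: closed_half_space.
exact: closed_norm_ball.
Qed.

Lemma chart_half_space c p : is_chart c -> cdom c p -> half_space (cmap c p).
Proof.
move=> [_ [U _ imc] _ _ _] cp.
have : (cmap c @` cdom c) (cmap c p) by exists p.
by rewrite imc => -[].
Qed.

Lemma chartK c p : is_chart c -> cdom c p -> cinv c (cmap c p) = p.
Proof. by move=> [_ _ cK _ _] cp; apply: cK; exact: mem_set. Qed.

Lemma chart_continuous c p : is_chart c -> cdom c p ->
  {for p, continuous (cmap c)}.
Proof.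
move=> [oc _ _ ctc _] cp.
have /subspace_continuousP/(_ p cp) := ctc.
by rewrite within_interior//; exact: open_nbhs_nbhs.
Qed.

(** The image of a chart is relatively open in the half-space, hence contains
    small boxes, boundary points included. *)
Lemma chart_box c p (O : set M) : is_chart c -> cdom c p -> nbhs p O ->
  exists2 r, 0 < r & forall y, coord_box (cmap c p) r y ->
    [/\ cdom c (cinv c y), O (cinv c y) & cmap c (cinv c y) = y].
Proof.
move=> cc cp Op; have [oc [U oU imc] cK ctc cti] := cc.
have im_p : (cmap c @` cdom c) (cmap c p) by exists p.
have /subspace_continuousP/(_ _ im_p) := cti.
rewrite /from_subspace chartK// => H.
have {}H : \forall y \near cmap c p, (cmap c @` cdom c) y -> O (cinv c y).
  exact: H.
have Up : \forall y \near cmap c p, U y.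
  by apply: open_nbhs_nbhs; split => //; move: im_p; rewrite imc => -[].
have [r /= r0 rP] := iffLR (@nbhs_ballP R 'rV[R]_n _ _) (filterI H Up).
exists (r / 2); first by rewrite divr_gt0.
move=> y [/= py hy].
have [|Oy Uy] := rP y.
  rewrite -ball_normE /=; apply: le_lt_trans py _; rewrite ltr_pdivrMr//; lra.
have im_y : (cmap c @` cdom c) y by rewrite imc.
have := Oy im_y; case: im_y => q cq <-.
by rewrite chartK.
Qed.

Lemma chart_box_compact c p r : is_chart c ->
  (forall y, coord_box (cmap c p) r y ->
    cdom c (cinv c y) /\ cmap c (cinv c y) = y) ->
  compact (cinv c @` coord_box (cmap c p) r).
Proof.
move=> [_ _ _ _ cti] bP; apply: continuous_compact; last exact: coord_box_compact.
apply: continuous_subspaceW cti => y /bP[cy yE]; exists (cinv c y) => //.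
Qed.

End charts.

(** * The C^1 topology *)

Section C1_topology.
Variables (R : realType) (n : nat) (M : topologicalType).
Variables (A : set (chart R n M)) (HA : C1_atlas A) (C : set M).
Implicit Types (f g : Diff1_type A C) (p q : M).

Lemma nbhs_C1_close f c d (L : set M) (e : R) :
  A c -> A d -> compact L -> L `<=` cdom c -> val f @` L `<=` cdom d -> 0 < e ->
  \forall g \near f, C1_close (val f) c d L e (val g).
Proof.
move=> Ac Ad cL Lc fLd e0.
have fP : C1_map A (val f) by have [[]] := set_mem (valP f).
apply: open_nbhs_nbhs; split; last first.
  by split => // x Lx; rewrite !subrr !normr0.
exists [set [set g : Diff1_type A C | C1_close (val f) c d L e (val g)]].
  move=> _ ->.
  apply: (@finI_from1 _ _ (C1_subbase A)
    (fun W => [set g : Diff1_type A C | W (val g)])).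
  by exists (val f), c, d, L, e.
by rewrite bigcup_set1.
Qed.

Lemma atlas_chart c : A c -> is_chart c.
Proof. by case: HA => H _ _; exact: H. Qed.

Lemma atlas_cover p : exists2 c, A c & cdom c p.
Proof. by case: HA => _ H _; have : setT p by []; rewrite -H => -[c Ac cp]; exists c. Qed.

Lemma Diff1_C1 f : C1_map A (val f).
Proof. by have [[]] := set_mem (valP f). Qed.

Lemma Diff1_cts f : continuous (val f).
Proof. by case: (Diff1_C1 f). Qed.

Lemma chart_dom_nbhs c p : A c -> cdom c p -> nbhs p (cdom c).
Proof. by move=> /atlas_chart[oc _ _ _ _] cp; exact: open_nbhs_nbhs. Qed.

(** Compact coordinate boxes [L] on which the chart [d] can express [f]: the
    data from which the subbasic neighbourhoods of [f] are made. *)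
Lemma C1_compact_box f p c d (N : set M) :
  A c -> A d -> cdom c p -> cdom d (val f p) -> nbhs p N ->
  exists2 r, 0 < r & let L := cinv c @` coord_box (cmap c p) r in
    [/\ compact L, L `<=` cdom c, L `<=` N, val f @` L `<=` cdom d &
        forall y, coord_box (cmap c p) r y -> cmap c (cinv c y) = y].
Proof.
move=> Ac Ad cp dfp Np.
have Nf : nbhs p (N `&` val f @^-1` cdom d).
  by apply: filterI => //; apply: Diff1_cts; exact: chart_dom_nbhs.
have [r r0 rP] := chart_box (atlas_chart Ac) cp Nf.
exists r => //; split.
- by apply: chart_box_compact; [exact: atlas_chart|move=> y /rP[]].
- by move=> _ [y /rP[]] ? _ _ <-.
- by move=> _ [y /rP[]] _ [] ? _ _ <-.
- by move=> _ [_ [y /rP[]] _ [] _ ? _ <- <-].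
- by move=> y /rP[].
Qed.

(** Joint continuity of evaluation: the part of the C^1 topology that controls
    values. *)
Lemma eval_near f p (O : set M) : nbhs (val f p) O ->
  \forall q \near p & g \near f, O (val g q).
Proof.
move=> Ofp; have [c Ac cp] := atlas_cover p; have [d Ad dfp] := atlas_cover (val f p).
have [r2 r20 r2P] := chart_box (atlas_chart Ad) dfp Ofp.
pose N := [set q | cdom d (val f q) /\
                   ball (cmap d (val f p)) (r2 / 2) (cmap d (val f q))].
have Np : nbhs p N.
  apply: filterI; first by apply: Diff1_cts; exact: chart_dom_nbhs.
  apply: (@Diff1_cts f p [set q | ball (cmap d (val f p)) (r2 / 2) (cmap d q)]).
  apply: (chart_continuous (atlas_chart Ad) dfp).
  by apply: nbhsx_ballx; rewrite divr_gt0.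
have [r r0 /= [cL Lc LN fLd rK]] := C1_compact_box Ac Ad cp dfp Np.
exists ([set q | cdom c q /\ ball (cmap c p) r (cmap c q)],
  [set g : Diff1_type A C | C1_close (val f) c d
    (cinv c @` coord_box (cmap c p) r) (r2 / 2) (val g)]).
  split => /=.
    apply: filterI; first exact: chart_dom_nbhs.
    by apply: (chart_continuous (atlas_chart Ac) cp); exact: nbhsx_ballx.
  by apply: nbhs_C1_close => //; rewrite divr_gt0.
move=> [q g] /= [[cq bq] [gLd gclose]].
have Lq : (cinv c @` coord_box (cmap c p) r) q.
  exists (cmap c q); last by rewrite chartK//; exact: atlas_chart.
  split; last by apply: chart_half_space => //; exact: atlas_chart.
  by apply/ltW; move: bq; rewrite -ball_normE.
have [_ bfq] := LN _ Lq.
have [] := gclose q Lq; rewrite /Defs.coord /= chartK//; last exact: atlas_chart.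
move=> gfq _; have dgq : cdom d (val g q) by apply: gLd; exists q.
rewrite -(chartK (atlas_chart Ad) dgq).
suff /r2P[] : coord_box (cmap d (val f p)) r2 (cmap d (val g q)) by [].
split; last by apply: chart_half_space => //; exact: atlas_chart.
move: bfq; rewrite -ball_normE /= => bfq.
rewrite -(subrK (cmap d (val f q)) (cmap d (val f p))) -addrA.
apply: le_trans (ler_normD _ _) _; rewrite [X in _ + X]distrC; lra.
Qed.

Lemma coord_domP (f : M -> M) (c d : chart R n M) q : cdom c q -> cdom d (f q) ->
  coord_dom c d f (cmap c q).
Proof. by move=> cq dfq; exists q. Qed.

(** Strict differentiability, uniformly for [g] close to [f]: the differential
    [L] of [f] at [p] serves for all of them. On a box, [g - f] has a small
    differential in charts, so it is Lipschitz with a small constant. *)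
Lemma C1_strict_near f p c d :
  A c -> A d -> cdom c p -> cdom d (val f p) ->
  exists L : {linear 'rV[R]_n -> 'rV[R]_n}, forall e, 0 < e ->
  exists2 r, 0 < r & \forall g \near f, forall q1 q2, cdom c q1 -> cdom c q2 ->
    ball (cmap c p) r (cmap c q1) -> ball (cmap c p) r (cmap c q2) ->
    [/\ cdom d (val g q1), cdom d (val g q2) &
     `|cmap d (val g q1) - cmap d (val g q2) - L (cmap c q1 - cmap c q2)|
       <= e * `|cmap c q1 - cmap c q2|].
Proof.
move=> Ac Ad cp dfp.
have cc := atlas_chart Ac; have cd := atlas_chart Ad.
have [r0 r00 /= [cL Lc _ fLd rK]] := C1_compact_box Ac Ad cp dfp filterT.
set B := coord_box (cmap c p) r0 in cL Lc fLd rK.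
pose D (g : Diff1_type A C) := coord_dom c d (val g).
pose F (g : Diff1_type A C) := Defs.coord c d (val g).
have BD g : val g @` (cinv c @` B) `<=` cdom d -> B `<=` D g.
  move=> gLd y By; rewrite -(rK _ By); apply: coord_domP.
    by apply: Lc; exists y.
  by apply: gLd; exists (cinv c y) => //; exists y.
have C1F g : C1_within (D g) (F g) by have [_] := Diff1_C1 g; exact.
have cB : is_convex B by exact: coord_box_convex.
exists ('d (F f) (within (D f) (nbhs (cmap c p)))) => e e0.
have e20 : 0 < e / 2 by rewrite divr_gt0.
have [r1 r10 Fstrict] := strict_diff (@bounded_frame_row R n) (C1F f)
  (coord_domP cp dfp) cB (BD _ fLd) e20.
(* A matrix with entries bounded by [k] has operator norm at most [n * k],
   for the sup norm on row vectors. *)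
pose k := e / 2 / (n%:R + 1).
have n10 : 0 < n%:R + 1 :> R by rewrite ltr_wpDl.
have k0 : 0 < k by rewrite divr_gt0.
exists (Num.min r0 r1); first by rewrite lt_min r00.
apply: filterS (nbhs_C1_close Ac Ad cL Lc fLd k0) => g [gLd gclose].
have FGlip : forall x y, B x -> B y ->
    `|(F g y - F f y) - (F g x - F f x)| <= e / 2 * `|y - x|.
  apply: (mean_value_diff_sub cB (BD _ fLd) (BD _ gLd) (ltW e20)).
  - by move=> x /(BD _ fLd) Dx; exact: (proj1 (C1F f)).
  - by move=> x /(BD _ gLd) Dx; exact: (proj1 (C1F g)).
  - move=> x v Bx; have [_] := gclose (cinv c x) (imageP _ Bx).
    rewrite (rK _ Bx) /coord_jacobian /jacobian_within => /ltW H.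
    apply: le_trans (linear_bound (@bounded_frame_row R n)
      (fun j => lin1_mx_dist j H) v) _.
    rewrite ler_wpM2r// /k mulrCA -[leRHS]mulr1 ler_wpM2l ?(ltW e20)//.
    by rewrite ler_pdivrMr// mul1r lerDl.
move=> q1 q2 cq1 cq2; rewrite -ball_normE /= !lt_min => /andP[a0 a1] /andP[b0 b1].
have inB q : cdom c q -> `|cmap c p - cmap c q| < r0 -> B (cmap c q).
  by move=> cq qr; split; [exact: ltW|exact: chart_half_space].
have dq q : cdom c q -> `|cmap c p - cmap c q| < r0 -> cdom d (val g q).
  move=> cq qr; apply: gLd; exists q => //; exists (cmap c q); first exact: inB.
  exact: chartK.
split; [exact: dq|exact: dq|].
have FE h q : cdom c q -> cmap d (val h q) = F h (cmap c q).
  by move=> cq; rewrite /F /Defs.coord /= chartK.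
rewrite !FE//.
have bF : ball (cmap c p) r1 (cmap c q1) by rewrite -ball_normE.
have bG : ball (cmap c p) r1 (cmap c q2) by rewrite -ball_normE.
apply: le_trans (dist_perturb
  (Fstrict _ _ (inB _ cq1 a0) (inB _ cq2 b0) bF bG)
  (FGlip _ _ (inB _ cq2 b0) (inB _ cq1 a0))) _.
by rewrite -mulrDl -splitr.
Qed.

End C1_topology.

(** * Embedded curves *)

Lemma linear_line_dist (R : realType) (W : normedModType R)
    (L : {linear R^o -> W}) (a : W) (t : R) (k : R) :
  `|a - L t| <= k -> `|a - t *: L 1| <= k.
Proof. by rewrite -linearZ /= [t *: _]mulr1. Qed.

Section curves.
Variables (R : realType) (n : nat) (M : topologicalType).
Variables (A : set (chart R n M)) (HA : C1_atlas A).
Variables (i : interval R) (gamma : R -> M) (Hgamma : C1_embedding A i gamma).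

Lemma is_convex_itv : @is_convex R R^o [set` i].
Proof.
move=> x y t /= xi yi /andP[t0 t1].
have := @interval_is_interval _ i; rewrite /is_interval => H.
rewrite /GRing.scale /=.
have [xy|/ltW yx] := leP x y.
  apply: (H x y) => //; have := subr_ge0 x y; rewrite xy => yx0.
  have : t * (y - x) <= 1 * (y - x) by rewrite ler_wpM2r.
  have : 0 <= t * (y - x) by rewrite mulr_ge0.
  by rewrite mul1r => ? ?; apply/andP; split; lra.
apply: (H y x) => //; have := subr_ge0 y x; rewrite yx => yx0.
have : t * (x - y) <= 1 * (x - y) by rewrite ler_wpM2r.
have : 0 <= t * (x - y) by rewrite mulr_ge0.
by rewrite mul1r => ? ?; apply/andP; split; lra.
Qed.

Lemma curve_within x (O : set M) : x \in i -> nbhs (gamma x) O ->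
  \forall y \near x, y \in i -> O (gamma y).
Proof.
move=> xi Ox; have [/subspace_continuousP/(_ x xi) H _ _] := Hgamma.
exact: H.
Qed.

(** A C^1 curve is strictly differentiable too, with a velocity [w] that does
    not vanish, by immersion. *)
Lemma curve_strict x c : A c -> x \in i -> cdom c (gamma x) ->
  exists2 w : 'rV[R]_n, w != 0 & forall e, 0 < e -> exists2 r, 0 < r &
    forall y z, y \in i -> z \in i -> ball x r y -> ball x r z ->
    [/\ cdom c (gamma y), cdom c (gamma z) &
     `|cmap c (gamma y) - cmap c (gamma z) - (y - z) *: w| <= e * `|y - z|].
Proof.
move=> Ac xi cx; have [_ _ /(_ c Ac)] := Hgamma.
set D : set R^o := _ `&` _; set h : R^o -> _ := _ \o _ => -[C1h /(_ x) w0].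
have Dx : D x by [].
exists ('d h (within D (nbhs (x : R^o))) 1); first exact: w0.
move=> e e0; have /nbhs_ballP[r0 /= r00 Hr0] :=
  curve_within xi (chart_dom_nbhs HA Ac cx).
pose B : set R^o := [set` i] `&` ball (x : R^o) r0.
have cB : is_convex B.
  by apply: is_convexI; [exact: is_convex_itv|exact: is_convex_ball].
have BD : B `<=` D by move=> y [yi xy]; split => //; exact: Hr0.
have [r r_gt0 Hr] := strict_diff (@bounded_frame_line R) C1h Dx cB BD e0.
exists (Num.min r r0); first by rewrite lt_min r_gt0.
move=> y z yi zi; rewrite -ball_normE /= !lt_min => /andP[yr yr0] /andP[zr zr0].
split; [exact: Hr0|exact: Hr0|].
exact: linear_line_dist (Hr y z (conj yi yr0) (conj zi zr0) yr zr).
Qed.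

End curves.

(** * The parameter maps *)

Lemma norm_le_of_slope (R : realType) (V : normedModType R) (u w : V) (t h : R) :
  h <= 1 -> `|u - t *: w| <= h * `|t| -> `|u| <= (`|w| + 1) * `|t|.
Proof.
move=> h1 H; rewrite -(subrK (t *: w) u) mulrDl addrC.
apply: le_trans (ler_normD _ _) _; rewrite normrZ mulrC lerD2l.
by apply: le_trans H _; rewrite ler_wpM2r.
Qed.

(** [u] and [v] are the increments, in charts, of the curve and of its image
    under a diffeomorphism with differential [L]; [t] and [s] are the increments
    of their parameters, and [w], [w2] the velocities. *)
Lemma slope_transport (R : realType) n (L : {linear 'rV[R]_n -> 'rV[R]_n})
    (u v w w2 : 'rV[R]_n) (s t h a : R) j :
  0 <= h -> h <= 1 -> 0 <= a -> (forall x, `|L x| <= a * `|x|) ->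
  `|u - t *: w| <= h * `|t| -> `|v - L u| <= h * `|u| ->
  `|v - s *: w2| <= h * `|s| ->
  `|s * w2 0 j - t * L w 0 j| <= h * (`|w| + 1 + a) * `|t| + h * `|s|.
Proof.
move=> h0 h1 a0 La Hu Hv Hs.
have u_le := norm_le_of_slope h1 Hu.
have -> : s * w2 0 j - t * L w 0 j = (s *: w2 - t *: L w) 0 j by rewrite !mxE.
apply: le_trans (mx_entry_le_norm _ _ _) _.
have -> : s *: w2 - t *: L w = (v - L u) + L (u - t *: w) - (v - s *: w2).
  by rewrite -linearZ linearB addrA subrK subrACA subrr sub0r opprB.
apply: le_trans (ler_normB _ _) (lerD _ Hs).
apply: le_trans (ler_normD _ _) _; rewrite mulrDr mulrDl.
apply: lerD; first by apply: le_trans Hv _; rewrite -mulrA ler_wpM2l.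
by apply: le_trans (La _) _; rewrite -mulrA mulrCA ler_wpM2l.
Qed.

(** From [`|s * b - t * u| <= small * (`|t| + `|s|)], the term in [s] is
    absorbed in the left-hand side to give the slope [u / b]. *)
Lemma slope_absorb (R : realType) (s t b u c1 h e : R) :
  b != 0 -> 0 <= c1 -> 0 <= h -> h <= `|b| / 2 ->
  2 * h * (c1 + `|u / b|) <= e * `|b| ->
  `|s * b - t * u| <= h * c1 * `|t| + h * `|s| ->
  `|s - u / b * t| <= e * `|t|.
Proof.
move=> b0 c10 h0 hb he H.
have bp : 0 < `|b| by rewrite normr_gt0.
set d := u / b in he *; set D := `|s - d * t|.
have H1 : D * `|b| <= h * c1 * `|t| + h * `|s|.
  by rewrite /D -normrM mulrBl mulrAC /d divfK// [u * t]mulrC.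
have H2 : `|s| <= D + `|d| * `|t|.
  by rewrite -normrM -{1}(subrK (d * t) s); exact: ler_normD.
have H3 : h * `|s| <= h * (D + `|d| * `|t|) by rewrite ler_wpM2l.
have H4 : h * D <= `|b| / 2 * D by rewrite ler_wpM2r /D.
have H5 : 2 * h * (c1 + `|d|) * `|t| <= e * `|b| * `|t| by rewrite ler_wpM2r.
rewrite -(ler_pM2r bp); lra.
Qed.

Section curve_map.
Variables (R : realType) (n : nat) (M : topologicalType).
Variables (A : set (chart R n M)) (HA : C1_atlas A).
Variables (i : interval R) (gamma : R -> M) (Hgamma : C1_embedding A i gamma).
Variables (K : set R) (Ki : K `<=` [set` i]).

Definition curve_inv : M -> R :=
  projT1 (cid (let: And3 _ H _ := Hgamma in H)).

Lemma curve_invK : {in i, cancel gamma curve_inv}.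
Proof. by rewrite /curve_inv; case: cid => g []. Qed.

Lemma curve_inv_continuous : {within gamma @` [set` i], continuous curve_inv}.
Proof. by rewrite /curve_inv; case: cid => g []. Qed.

Local Notation C := (gamma @` K).
Local Notation G := (Diff1_type A C).
Implicit Types f g : G.

(** [f] read in the parameter of the curve; it is meaningful on [K], which it
    maps to itself. *)
Definition curve_map f (y : R) : R := curve_inv (val f (gamma y)).

Lemma curve_mapE f y : curve_map f y = curve_inv (val f (gamma y)).
Proof. by []. Qed.

Lemma curve_map_spec f y : K y ->
  K (curve_map f y) /\ gamma (curve_map f y) = val f (gamma y).
Proof.
move=> Ky; have [_ fC] := set_mem (valP f).
have : C (val f (gamma y)).
  by rewrite -[X in X _]fC; exists (gamma y) => //; exists y.
by move=> [z Kz zE]; rewrite /curve_map -zE curve_invK//; exact: Ki.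
Qed.

Lemma curve_map_in f y : K y -> K (curve_map f y).
Proof. by case/(curve_map_spec f). Qed.

Lemma curve_map_gamma f y : K y -> gamma (curve_map f y) = val f (gamma y).
Proof. by case/(curve_map_spec f). Qed.

Lemma curve_map_inj f y z : K y -> K z -> curve_map f y = curve_map f z -> y = z.
Proof.
move=> Ky Kz yz; have := curve_map_gamma f Ky; rewrite yz curve_map_gamma//.
have [[_ [h [_ fK _]]] _] := set_mem (valP f).
move=> /(can_inj fK) /(congr1 curve_inv); rewrite !curve_invK//; exact: Ki.
Qed.

Lemma curve_map_surj f y : K y -> exists2 z, K z & curve_map f z = y.
Proof.
move=> Ky; have [_ fC] := set_mem (valP f).
have : C (gamma y) by exists y.
rewrite -[X in X _]fC => -[_ [z Kz <-] zE]; exists z => //.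
by rewrite /curve_map zE curve_invK//; exact: Ki.
Qed.

Lemma near_curve_map f x (r : R) : K x -> 0 < r ->
  \forall y \near x & g \near f, K y -> ball (curve_map f x) r (curve_map g y).
Proof.
move=> Kx r0; have xi : x \in i by exact: Ki.
have ix' : (gamma @` [set` i]) (val f (gamma x)).
  by rewrite -curve_map_gamma//; exists (curve_map f x) => //; apply: Ki; exact: curve_map_in.
have H : \forall p \near val f (gamma x), (gamma @` [set` i]) p ->
    ball (curve_map f x) r (curve_inv p).
  have /subspace_continuousP/(_ _ ix') cv := curve_inv_continuous.
  exact: cv _ (nbhsx_ballx _ r r0).
have [[U V] /= [Ux Vf] UV] := eval_near HA H.
exists ([set y | y \in i -> U (gamma y)], V) => /=.
  by split => //; apply: (curve_within Hgamma).
move=> [y g] /= [Uy Vg] Ky; have yi : y \in i by exact: Ki.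
apply: (UV (gamma y, g)); first by split => //=; exact: Uy.
by rewrite /= -curve_map_gamma//; exists (curve_map g y) => //; apply: Ki; exact: curve_map_in.
Qed.

Lemma curve_map_continuous f : {within K, continuous (curve_map f)}.
Proof.
apply/subspace_continuousP => x Kx; apply/cvgrPdist_lt => e e0.
have [[U V] /= [Ux Vf] UV] := near_curve_map f Kx e0.
apply: filterS Ux => y Uy Ky.
have := UV (y, f) (conj Uy (nbhs_singleton Vf)) Ky.
by rewrite -ball_normE.
Qed.

(** [gamma \o curve_map g = g \o gamma] on [K]. In charts, both sides have
    increments proportional to those of the parameters up to small errors, and
    a coordinate [j] in which the velocity [w2] at the image point does not
    vanish yields the slope. *)
Lemma strict_slope_near f x : K x -> exists d, forall e, 0 < e ->
  exists2 r, 0 < r & \forall g \near f, forall y z, K y -> K z ->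
    ball x r y -> ball x r z ->
    `|curve_map g y - curve_map g z - d * (y - z)| <= e * `|y - z|.
Proof.
move=> Kx; have xi : x \in i by exact: Ki.
have Kx' := curve_map_in f Kx; have xi' : curve_map f x \in i by exact: Ki.
have [c Ac cx] := atlas_cover HA (gamma x).
have [d Ad dfx] := atlas_cover HA (val f (gamma x)).
have dx' : cdom d (gamma (curve_map f x)) by rewrite curve_map_gamma.
have cc := atlas_chart HA Ac.
have [w w0 curve1] := curve_strict HA Hgamma Ac xi cx.
have [w2 w20 curve2] := curve_strict HA Hgamma Ad xi' dx'.
have [L HL] := C1_strict_near HA Ac Ad cx dfx.
have [j w2j] : exists j, w2 0 j != 0.
  apply/not_existsP => w2E; move: w20; apply/negP; rewrite negbK.
  by apply/eqP/rowP => j; rewrite mxE; apply/eqP; have /negP := w2E j; rewrite negbK.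
have [a a0 La] : exists2 a, 0 <= a & forall v, `|L v| <= a * `|v|.
  exists (n%:R * \big[Num.max/0]_k `|L (delta_mx 0 k)|).
    by rewrite mulr_ge0// bigmax_idl le_max lexx.
  by apply: (linear_bound (@bounded_frame_row R n)) => k; exact: le_bigmax.
(* [c1] is the constant of [slope_transport]; [h] below is small enough for
   [slope_absorb]. *)
pose c1 := `|w| + 1 + a; pose sl := L w 0 j / w2 0 j.
have c10 : 0 < c1 by rewrite /c1 ltr_wpDr// ltr_wpDl.
exists sl => e e0.
have bp : 0 < `|w2 0 j| by rewrite normr_gt0.
pose h := Num.min 1 (Num.min (`|w2 0 j| / 2) (e * `|w2 0 j| / (2 * (c1 + `|sl|)))).
have csl : 0 < 2 * (c1 + `|sl|) by rewrite mulr_gt0// ltr_wpDr.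
have h0 : 0 < h by rewrite !lt_min ltr01 !divr_gt0// mulr_gt0.
have h1 : h <= 1 by rewrite ge_min lexx.
have hb : h <= `|w2 0 j| / 2 by rewrite !ge_min lexx orbT.
have he : 2 * h * (c1 + `|sl|) <= e * `|w2 0 j|.
  rewrite mulrAC mulrC -ler_pdivlMr//.
  by rewrite !ge_min lexx !orbT.
have [r1 r10 Hr1] := curve1 h h0.
have [r2 r20 Hr2] := curve2 h h0.
have [r3 r30 Hr3] := HL h h0.
have [[U V] /= [Ux Vf] UV] := near_curve_map f Kx r20.
have /nbhs_ballP[r4 /= r40 Hr4] := Ux.
pose r5 := r3 / (`|w| + 1).
have w10 : 0 < `|w| + 1 by rewrite ltr_wpDl.
have r50 : 0 < r5 by rewrite divr_gt0.
exists (Num.min r1 (Num.min r4 r5)); first by rewrite !lt_min r10 r40.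
apply: filterS2 Vf Hr3 => g Vg Hg y z Ky Kz.
rewrite -ball_normE /= !lt_min => /and3P[y1 y4 y5] /and3P[z1 z4 z5].
have curvex t : K t -> `|x - t| < r1 -> `|x - t| < r5 ->
    cdom c (gamma t) /\ ball (cmap c (gamma x)) r3 (cmap c (gamma t)).
  move=> Kt t1 t5; have tr1 : ball x r1 t by rewrite -ball_normE.
  have [ct _ H] := Hr1 t x (Ki Kt) xi tr1 (ballxx _ r10).
  split => //; rewrite -ball_normE /= distrC.
  apply: le_lt_trans (norm_le_of_slope h1 H) _.
  by rewrite mulrC -ltr_pdivlMr// distrC.
have [cy by3] := curvex _ Ky y1 y5; have [cz bz3] := curvex _ Kz z1 z5.
have [_ _ Hu] : [/\ cdom c (gamma y), cdom c (gamma z) &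
    `|cmap c (gamma y) - cmap c (gamma z) - (y - z) *: w| <= h * `|y - z|].
  by apply: Hr1; rewrite -?ball_normE//; exact: Ki.
have [_ _ Hv] := Hg _ _ cy cz by3 bz3.
have Uy : ball (curve_map f x) r2 (curve_map g y).
  by apply: (UV (y, g)) => //; split => //; apply: Hr4; rewrite -ball_normE.
have Uz : ball (curve_map f x) r2 (curve_map g z).
  by apply: (UV (z, g)) => //; split => //; apply: Hr4; rewrite -ball_normE.
have [_ _] := Hr2 _ _ (Ki (curve_map_in g Ky)) (Ki (curve_map_in g Kz)) Uy Uz.
rewrite !curve_map_gamma// => Hs.
apply: (slope_absorb w2j (ltW c10) (ltW h0) hb he).
exact: slope_transport (ltW h0) h1 a0 La Hu Hv Hs.
Qed.

End curve_map.

(** * Clopen pieces of a sparse set *)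

Lemma compact_seq_cover (T : ptopologicalType) (I : choiceType) (K : set T)
    (N : I -> set T) (P : I -> Prop) :
  compact K -> (forall x, K x -> exists2 c, P c & nbhs x (N c)) ->
  exists2 s : seq I, (forall c, c \in s -> P c) &
    forall x, K x -> exists2 c, c \in s & N c x.
Proof.
move=> + KN; rewrite compact_cover => cK.
have [|x Kx|s sP Ks] := cK I P (fun c => (N c)°).
- by move=> c _; exact: open_interior.
- by have [c Pc Nc] := KN x Kx; exists c.
- exists (finmap.enum_fset s); first by move=> c /sP; exact: set_mem.
  by move=> x /Ks[c /= cs /interior_subset Nx]; exists c.
Qed.

(** If two rational points of [(a, b)] belong to [K], there is a gap of [K]
    between them. *)
Lemma sparse_rat_gap (R : realType) (K : set R) (a b : R) :
  sparse K -> a < b -> exists2 q : rat, ~ K (ratr q) & a < ratr q < b.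
Proof.
move=> [sigma _ sK] ab.
have [t1] := rat_in_itvoo ab; rewrite in_itv/= => /andP[at1 t1b].
have [Kt1|nKt1] := pselect (K (ratr t1)); last by exists t1; rewrite ?at1.
have [t2] := rat_in_itvoo t1b; rewrite in_itv/= => /andP[t12 t2b].
have [Kt2|nKt2] := pselect (K (ratr t2)); last first.
  by exists t2 => //; rewrite t2b andbT (lt_trans at1).
have [u [v [[uv _ _ uvK] uvt _]]] := sK _ _ Kt1 Kt2 t12.
have [t3 t3uv] := rat_in_itvoo uv; exists t3; first exact: uvK.
have := uvt _ t3uv; rewrite itvooE => /andP[h1 h2].
by rewrite (lt_trans at1 h1) (lt_trans h2 t2b).
Qed.

Lemma compact_piece (R : realType) (K : set R) (q r : R) :
  compact K -> ~ K q -> ~ K r -> compact (K `&` `]q, r[).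
Proof.
move=> cK nq nr.
have -> : K `&` `]q, r[ = K `&` `[q, r].
  have ccE x : `[q, r]%classic x = (q <= x <= r) :> Prop by rewrite /= in_itv.
  apply/seteqP; split => x [Kx]; rewrite ?ccE ?itvooE => /andP[qx xr].
    by split; rewrite // ccE !ltW.
  split; rewrite // itvooE !lt_neqAle qx xr !andbT; apply/andP; split.
    by apply/eqP => qxE; apply: nq; rewrite qxE.
  by apply/eqP => qxE; apply: nr; rewrite -qxE.
apply: compact_closedI => //; exact: interval_closed.
Qed.

Lemma compact_copiece (R : realType) (K : set R) (q r : R) :
  compact K -> compact (K `\` (K `&` `]q, r[)).
Proof.
move=> cK; have -> : K `\` (K `&` `]q, r[) = K `&` ~` `]q, r[.
  apply/seteqP; split => x [Kx nx]; split => //; first by move=> ?; apply: nx.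
  by case.
by apply: compact_closedI => //; apply: open_closedC; exact: interval_open.
Qed.

Lemma rat_interval_separation (R : realType) (E F : set R) :
  compact E -> compact F -> E `&` F = set0 ->
  exists s : seq (rat * rat),
    (forall x, E x -> exists2 ab, ab \in s & ratr ab.1 < x < ratr ab.2) /\
    (forall x, F x -> forall ab, ab \in s -> ~~ (ratr ab.1 < x < ratr ab.2)).
Proof.
move=> cE cF EF.
have clF : closed F by apply: compact_closed => //; exact: Rhausdorff.
have [|s sF sE] := @compact_seq_cover R (rat * rat)%type E
  (fun ab => [set x | ratr ab.1 < x < ratr ab.2])
  (fun ab => forall x, F x -> ~~ (ratr ab.1 < x < ratr ab.2)) cE.
  move=> x Ex; have nFx : ~ F x by move=> Fx; have : (E `&` F) x by []; rewrite EF.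
  have : nbhs x (~` F) by apply: open_nbhs_nbhs; split => //; exact: closed_openC.
  move=> /nbhs_ballP[e /= e0 eF].
  have [a] := @rat_in_itvoo R (x - e) x ltac:(lra).
  rewrite in_itv/= => /andP[a1 a2].
  have [b] := @rat_in_itvoo R x (x + e) ltac:(lra).
  rewrite in_itv/= => /andP[b1 b2].
  exists (a, b) => /=.
    move=> y Fy; apply/negP => /andP[ay yb]; apply: (eF y) => //.
    by rewrite -ball_normE /= ltr_distl; apply/andP; split; lra.
  have : nbhs x (`]ratr a, ratr b[%classic : set R).
    by apply: open_nbhs_nbhs; split; [exact: interval_open|rewrite itvooE a2].
  by apply: filterS => y; rewrite itvooE.
by exists s; split => // x Fx ab /sF; exact.
Qed.

(** * Discreteness and countability *)

Section restrictions.
Variables (R : realType) (n : nat) (M : topologicalType).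
Variables (A : set (chart R n M)) (HA : C1_atlas A).
Variables (i : interval R) (gamma : R -> M) (Hgamma : C1_embedding A i gamma).
Variables (K : set R) (cK : compact K) (K_isolated : isolated K = set0).
Variable Ki : K `<=` [set` i].

Local Notation C := (gamma @` K).
Local Notation G := (Diff1_type A C).
Local Notation ind := (curve_map Hgamma).
Implicit Types f g : G.

Let ind_continuous f : {within K, continuous (ind f)}.
Proof. exact: curve_map_continuous. Qed.

Lemma Diff1_inverse f : exists g : G,
  cancel (val f) (val g) /\ cancel (val g) (val f).
Proof.
have [[C1f [h [C1h fK hK]]] fC] := set_mem (valP f).
have hP : Diff1 A C h.
  split; first by split => //; exists (val f).
  by rewrite -{1}fC image_comp (_ : h \o val f = id) ?image_id//; apply/funext.
by exists (exist _ h (mem_set hP)).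
Qed.

Lemma non_isolated x (r : R) : K x -> 0 < r ->
  exists y, [/\ K y, y != x & ball x r y].
Proof.
move=> Kx r0; apply: contrapT => H.
have : isolated K x.
  split; first exact: mem_set.
  exists (ball x r); first exact: nbhsx_ballx.
  apply/seteqP; split => [y [xy Ky]|_ ->]; last by split => //; exact: ballxx.
  by apply: contrapT => /eqP yx; apply: H; exists y.
by rewrite K_isolated.
Qed.

(** If the slope were zero, [f] would contract the increments at [x] by an
    arbitrary factor, while its inverse is Lipschitz near the image of [x]:
    [x] would be isolated in [K]. *)
Lemma strict_slope_neq0 f x : K x -> exists2 d, d != 0 & forall e, 0 < e ->
  exists2 r, 0 < r & \forall g \near f, forall y z, K y -> K z ->
    ball x r y -> ball x r z ->
    `|ind g y - ind g z - d * (y - z)| <= e * `|y - z|.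
Proof.
move=> Kx; have [d Hd] := strict_slope_near HA Hgamma Ki f Kx.
exists d => //; apply/eqP => d0.
have [h [fK hK]] := Diff1_inverse f.
have hind y : K y -> ind h (ind f y) = y.
  move=> Ky; rewrite curve_mapE (curve_map_gamma _ Ki)// fK curve_invK//; exact: Ki.
have Kx' := curve_map_in Hgamma Ki f Kx.
have [d' Hd'] := strict_slope_near HA Hgamma Ki h Kx'.
have [r1 r10 /nbhs_singleton H1] := Hd' 1 ltr01.
pose L := 1 + `|d'|.
have L0 : 0 < L by rewrite ltr_pwDl.
have L20 : 0 < 1 / (2 * L) by rewrite divr_gt0// mulr_gt0.
have [r2 r20 /nbhs_singleton H2] := Hd _ L20.
have [[U V] /= [Ux Vf] UV] := near_curve_map HA Hgamma Ki f Kx r10.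
have /nbhs_ballP[r3 /= r30 Hr3] := Ux.
have [y [Ky yx yr]] := @non_isolated x (Num.min r2 r3) Kx ltac:(by rewrite lt_min r20).
have yr2 : ball x r2 y by apply: le_ball yr; rewrite ge_min lexx.
have yr3 : ball x r3 y by apply: le_ball yr; rewrite ge_min lexx orbT.
have Uy : ball (ind f x) r1 (ind f y).
  by apply: (UV (y, f)) => //; split; [exact: Hr3|exact: nbhs_singleton Vf].
have := H1 _ _ (curve_map_in Hgamma Ki f Ky) Kx' Uy (ballxx _ r10).
have := H2 _ _ Ky Kx yr2 (ballxx _ r20).
rewrite !hind// d0 mul0r subr0.
set s := ind f y - ind f x; set t := y - x => h2 h1.
have tn0 : 0 < `|t| by rewrite normr_gt0 subr_eq0.
have h3 : `|t| <= L * `|s|.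
  rewrite -(subrK (d' * s) t) mulrDl; apply: le_trans (ler_normD _ _) _.
  by rewrite normrM lerD2r.
have : L * `|s| <= L * (1 / (2 * L) * `|t|) by rewrite ler_pM2l.
have -> : L * (1 / (2 * L) * `|t|) = `|t| / 2 by field; rewrite gt_eqF.
lra.
Qed.

(** The images of [E] and of [K `\` E] under [f] are disjoint compact sets, so
    that maps close to [f] keep the image of [E] away from the latter. *)
Lemma near_image_sub f (E : set R) : E `<=` K -> compact E -> compact (K `\` E) ->
  \forall g \near f, ind g @` E `<=` ind f @` E.
Proof.
move=> EK cE cKE.
have cF : closed (ind f @` (K `\` E)).
  apply: compact_closed; first exact: Rhausdorff.
  apply: continuous_compact => //.
  exact: (continuous_subspaceW (@subDsetl _ _ _) (@ind_continuous f)).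
have : near_covering_within E by apply/near_covering_withinP/compact_near_coveringP.
move=> /(_ _ (nbhs f) (fun g y => (ind f @` E) (ind g y)) _) H.
suff : \forall g \near f, E `<=` (fun y => (ind f @` E) (ind g y)).
  by apply: filterS => g gE _ [y Ey <-]; exact: gE.
apply: H => y Ey.
have nF : nbhs (ind f y) (~` (ind f @` (K `\` E))).
  apply: open_nbhs_nbhs; split; first exact: closed_openC.
  by move=> [z [Kz nEz]] /(curve_map_inj Ki Kz (EK _ Ey)) zy; apply: nEz; rewrite zy.
have /nbhs_ballP[r /= r0 rF] := nF.
apply: filterS (near_curve_map HA Hgamma Ki f (EK _ Ey) r0) => -[z g] /= H Ez.
have := rF _ (H (EK _ Ez)).
have [w Kw <-] := curve_map_surj Hgamma Ki f (curve_map_in Hgamma Ki g (EK _ Ez)).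
move=> nFw; exists w => //; apply: contrapT => nEw; apply: nFw.
by exists w.
Qed.

Variable sK : sparse K.

Definition piece (q r : rat) : set R := K `&` `]ratr q, ratr r[.

(** A rational slope does as well as the true one [d0], at the price of a
    larger error; rationality matters for countability only. *)
Lemma local_slope f x e : K x -> 0 < e -> exists q r d : rat,
  [/\ ratr q < x < ratr r, ~ K (ratr q), ~ K (ratr r), (ratr d : R) != 0 &
   \forall g \near f, slope_on (piece q r) (ratr d) e (ind g)].
Proof.
move=> Kx e0; have [d0 d0N Hd0] := strict_slope_neq0 f Kx.
have d0p : 0 < `|d0| by rewrite normr_gt0.
pose e1 := Num.min (e / 4) (1 / 2).
have e10 : 0 < e1 by rewrite lt_min !divr_gt0.
have e1e : e1 <= e / 4 by rewrite ge_min lexx.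
have e1h : e1 <= 1 / 2 by rewrite ge_min lexx orbT.
have [rho rho0 Hrho] := Hd0 (e1 * `|d0|) (mulr_gt0 e10 d0p).
have [|d] := @rat_in_itvoo R d0 (d0 + e1 * `|d0|).
  by rewrite ltrDl mulr_gt0.
rewrite in_itv/= => /andP[dl dr].
have dd0 : `|ratr d - d0| <= e1 * `|d0|.
  by rewrite ger0_norm; lra.
have dabs : `|d0| / 2 <= `|ratr d|.
  have : `|d0| <= `|ratr d| + `|ratr d - d0|.
    by rewrite -{1}(subKr (ratr d) d0) ler_normB.
  have : e1 * `|d0| <= 1 / 2 * `|d0| by rewrite ler_wpM2r.
  lra.
have [q nKq qx] := @sparse_rat_gap R K (x - rho) x sK ltac:(lra).
have [r nKr xr] := @sparse_rat_gap R K x (x + rho) sK ltac:(lra).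
exists q, r, d; split => //.
- by apply/andP; split; lra.
- by rewrite -normr_gt0; lra.
apply: filterS Hrho => g Hg y z [Ky]; rewrite itvooE => yqr [Kz].
rewrite itvooE => zqr.
have := Hg y z Ky Kz; rewrite -ball_normE /= => {}Hg.
have {}Hg : `|ind g y - ind g z - d0 * (y - z)| <= e1 * `|d0| * `|y - z|.
  by apply: Hg; rewrite ltr_distl; apply/andP; split; lra.
rewrite (_ : _ - _ * _ = (ind g y - ind g z - d0 * (y - z)) -
  (ratr d - d0) * (y - z)); last by ring.
apply: le_trans (ler_normB _ _) _; rewrite normrM.
apply: le_trans (lerD Hg (ler_wpM2r (normr_ge0 _) dd0)) _.
rewrite -mulrDl ler_wpM2r//.
have : e1 * `|d0| <= e / 4 * `|d0| by rewrite ler_wpM2r.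
have : e * (`|d0| / 2) <= e * `|ratr d| by rewrite ler_wpM2l// ltW.
lra.
Qed.

(** [2 * e / (1 - e)] is [sigma / 2] for the chosen [e]. *)
Let slope_tolerance : exists2 e : R, 0 < e & forall f g (q r : rat) (d : rat),
  ~ K (ratr q) -> ~ K (ratr r) -> (ratr d : R) != 0 ->
  ind g @` piece q r `<=` ind f @` piece q r ->
  slope_on (piece q r) (ratr d) e (ind f) ->
  slope_on (piece q r) (ratr d) e (ind g) ->
  forall y, piece q r y -> ind g y = ind f y.
Proof.
have [sigma s0 sKs] := sK; exists (sigma / (sigma + 4)).
  by rewrite divr_gt0// addr_gt0.
have s4 : 0 < sigma + 4 by rewrite addr_gt0.
move=> f g q r d nq nr d0 img sf sg.
apply: (sparse_slope_rigid (sigma := sigma) _ _ d0 _ _ _ img sf sg).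
- exact: compact_piece.
- exact: sigma_sparse_trace.
- by rewrite ltW// divr_gt0.
- by rewrite ltr_pdivrMr// mul1r ltrDl.
- have -> : 1 - sigma / (sigma + 4) = 4 / (sigma + 4) by field; rewrite gt_eqF.
  have -> : 2 * (sigma / (sigma + 4)) / (4 / (sigma + 4)) = sigma / 2.
    by field; rewrite gt_eqF.
  by rewrite ltr_pdivrMr//; lra.
Qed.

(** Rigidity gives the equality near each point of [K], and the compactness of
    [K] makes the neighbourhood of [f] independent of the point. *)
Lemma near_curve_map_eq f : \forall g \near f, forall y, K y -> ind g y = ind f y.
Proof.
have [e e0 He] := slope_tolerance.
have : near_covering_within K by apply/near_covering_withinP/compact_near_coveringP.
move=> /(_ _ (nbhs f) (fun g y => ind g y = ind f y) _); apply => x Kx.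
have [q [r [d [qxr nq nr d0 Hs]]]] := local_slope f Kx e0.
pose E := piece q r.
have Him : \forall g \near f, ind g @` E `<=` ind f @` E.
  apply: near_image_sub; [by move=> ? []| exact: compact_piece|exact: compact_copiece].
exists (`]ratr q, ratr r[%classic, [set g | slope_on E (ratr d) e (ind g) /\
   ind g @` E `<=` ind f @` E]) => /=.
  split; last exact: filterI.
  by apply: open_nbhs_nbhs; split; [exact: interval_open|rewrite itvooE].
move=> [y g] /= [yqr [sg img]] Ky.
by apply: (He f g q r d nq nr d0 img (nbhs_singleton Hs) sg).
Qed.

(** A piece of [K] given by its end points, a slope, and a list of intervals
    that cuts out of [K] the image of the piece, all of them rational. *)
Definition code : Type := (rat * rat * rat * seq (rat * rat))%type.

Definition describes (e : R) (c : code) f : Prop :=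
  [/\ ~ K (ratr c.1.1.1), ~ K (ratr c.1.1.2), (ratr c.1.2 : R) != 0,
      slope_on (piece c.1.1.1 c.1.1.2) (ratr c.1.2) e (ind f) &
      forall y, K y -> (ind f @` piece c.1.1.1 c.1.1.2) y <->
        exists2 ab, ab \in c.2 & (ratr ab.1 < y < ratr ab.2)].

Lemma describes_ex e f x : 0 < e -> K x ->
  exists2 c : code, describes e c f & nbhs x `]ratr c.1.1.1, ratr c.1.1.2[%classic.
Proof.
move=> e0 Kx; have [q [r [d [qxr nq nr d0 /nbhs_singleton Hs]]]] := local_slope f Kx e0.
pose E := piece q r.
have cimg (F : set R) : F `<=` K -> compact F -> compact (ind f @` F).
  move=> FK cF; apply: continuous_compact => //.
  exact: (continuous_subspaceW FK (@ind_continuous f)).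
have [|||s [sE sF]] := @rat_interval_separation R (ind f @` E) (ind f @` (K `\` E)).
- by apply: cimg; [move=> ? []|exact: compact_piece].
- by apply: cimg; [exact: subDsetl|exact: compact_copiece].
- apply/seteqP; split => // _ [[y [Ky yE] <-] [z [Kz nEz]]].
  by move=> /(curve_map_inj Ki Kz Ky) zy; apply: nEz; rewrite zy.
exists (q, r, d, s); last first.
  by apply: open_nbhs_nbhs; split; [exact: interval_open|rewrite itvooE].
split => // y Ky; split; first by move=> /sE.
move=> [ab abs yab]; have [z Kz zy] := curve_map_surj Hgamma Ki f Ky.
exists z => //; apply: contrapT => nEz.
have Fy : (ind f @` (K `\` E)) y by exists z.
by have := sF y Fy ab abs; rewrite yab.
Qed.

(** [D f] lists codes that describe [f] and whose pieces cover [K]. A code that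
    also describes [g] gives [f] and [g] the same slope and the same image on
    its piece, where they agree by rigidity. *)
Lemma finite_description : exists D : G -> seq code,
  forall f g, D f = D g -> forall y, K y -> ind g y = ind f y.
Proof.
have [e e0 He] := slope_tolerance.
have /choice[D HD] f : exists s : seq code, (forall c, c \in s -> describes e c f) /\
    forall x, K x -> exists2 c, c \in s & `]ratr c.1.1.1, ratr c.1.1.2[%classic x.
  have [|s s1 s2] := @compact_seq_cover R code K
    (fun c => `]ratr c.1.1.1, ratr c.1.1.2[%classic) (fun c => describes e c f) cK.
    by move=> x Kx; exact: describes_ex.
  by exists s.
exists D => f g DD y Ky.
have [Df /(_ y Ky)[c cD yc]] := HD f; have [Dg _] := HD g.
have [nq nr d0 sf imf] := Df c cD.
have [_ _ _ sg img] : describes e c g by apply: Dg; rewrite -DD.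
apply: (He f g c.1.1.1 c.1.1.2 c.1.2) => //.
move=> z gz; have Kz : K z by case: gz => w [Kw _] <-; exact: curve_map_in.
by apply/imf => //; exact/img.
Qed.

Lemma to_diff1_eq f g : (forall y, K y -> ind g y = ind f y) ->
  to_diff1 g = to_diff1 f.
Proof.
move=> gf; apply/val_inj/funext => -[x Cx]; apply: val_inj => /=.
have [y Ky <-] := set_mem Cx.
by rewrite -(curve_map_gamma Hgamma Ki g Ky) -(curve_map_gamma Hgamma Ki f Ky) gf.
Qed.

Lemma to_diff1_surj (u : diff1 A C) : exists f, to_diff1 f = u.
Proof.
have [f _ fu] := set_mem (valP u); exists f.
by apply: val_inj.
Qed.

End restrictions.

Theorem theorem3 (R : realType) (n : nat) (M : topologicalType)
  (A : set (chart R n M)) (HA : C1_atlas A) (HM : hausdorff_space M)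
  (cM : compact [set: M]) (oM : orientable A)
  (i : interval R) (gamma : R -> M) (Hgamma : C1_embedding A i gamma)
  (K : set R) (HK : cantor_set K) (Ki : K `<=` [set` i]) (sK : sparse K)
  (C : set M) (HC : C = gamma @` K) :
  countable [set: diff1 A C] /\ (forall U : set (diff1 A C), open U).
Proof.
subst C; have [_ cK _ K_isolated] := HK.
split.
  have [D HD] := finite_description HA Hgamma cK K_isolated Ki sK.
  have [lift liftK] := choice (@to_diff1_surj _ _ _ A gamma K).
  apply/countable_injP; exists (fun u => choice.pickle (D (lift u))).
  move=> u v _ _ /(pcan_inj (@choice.pickleK _)) /HD uv.
  by rewrite -(liftK u) -(liftK v) -(to_diff1_eq Ki uv).
move=> U; change (open ((@to_diff1 R n M A (gamma @` K)) @^-1` U)).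
rewrite openE => f Uf.
apply: filterS (near_curve_map_eq HA Hgamma cK K_isolated Ki sK f) => g gf.
by rewrite /= (to_diff1_eq Ki gf).
Qed.
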